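(* Let $r\in\mathbb R_{\ge2}$ be irrational. Below, $a/b$, $p/q$ and $a_n/b_n$ denote elements of $\mathbb Q_{\ge2}$. (a) For every $F\in\mathcal X\cup\{\alpha,\Theta\}$, $$\sup_{a/b<r}F(E_{a/b})=\inf_{a/b>r}F(E_{a/b}).$$ In particular, the function $\mathbb Q_{\ge2}\to\mathbb R:\ p/q\mapsto F(E_{p/q})$ has an extension $\tilde F$ to $\mathbb R_{\ge2}$ that is continuous at every irrational number, namely the one obtained by letting $\tilde F(s)=\sup_{a/b<s}F(E_{a/b})$ for every irrational $s\in\mathbb R_{\geq 2}$. (b) The continuity in (a) is uniform over all $F\in\mathcal X$ in the following sense: given any $\varepsilon>0$ there is a $\delta>0$ such that if $|r-p/q|<\delta$, then $\left|\sup_{a/b<r}F(E_{a/b})-F(E_{p/q})\right|<\varepsilon$ for every $F\in\mathcal X$. (c) If $a_n/b_n$ converges to $r$, then the sequence $E_{a_n/b_n}$ is Cauchy in the asymptotic spectrum distance.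
   Context: Graphs here are finite and simple. $E_n$ denotes the graph with $n$ vertices and no edges, $G\sqcup H$ the disjoint union, and $G\boxtimes H$ the strong product: its vertex set is $V(G)\times V(H)$, and distinct $(a,x),(b,y)$ are adjacent iff ($a=b$ or $\{a,b\}\in E(G)$) and ($x=y$ or $\{x,y\}\in E(H)$). A cohomomorphism $G\to H$ is a map $f:V(G)\to V(H)$ such that for all distinct non-adjacent $u,v\in V(G)$ the vertices $f(u),f(v)$ are distinct and non-adjacent in $H$. Write $G\le H$ if there is a cohomomorphism $G\to H$. $\alpha$ is the independence number, and $\Theta(G)=\lim_{n\to\infty}\alpha(G^{\boxtimes n})^{1/n}$ is the Shannon capacity. The asymptotic spectrum of graphs $\mathcal X$ is the set of all maps $F$ from finite graphs to $\mathbb R_{\ge 0}$ with $F(G\sqcup H)=F(G)+F(H)$, $F(G\boxtimes H)=F(G)F(H)$, $F(E_n)=n$ for all $n\in\mathbb N$, and $G\le H\Rightarrow F(G)\le F(H)$. The asymptotic spectrum distance is $d(G,H)=\sup_{F\in\mathcal X}|F(G)-F(H)|$; Cauchy is meant with respect to $d$. For positive integers $p,q$ with $p/q\ge 2$, the fraction graph $E_{p/q}$ has vertex set $\{0,\dots,p-1\}$, and distinct $u,v$ are adjacent iff $u-v \bmod p<q$ or $v-u\bmod p<q$. If $p/q=p'/q'$ as rational numbers then $E_{p/q}\le E_{p'/q'}\le E_{p/q}$, so $F(E_{p/q})$ depends only on the rational number $p/q$ for $F\in\mathcal X\cup\{\alpha,\Theta\}$. *)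

(* Defs.v *)
From HB Require Import structures.
From mathcomp Require Import all_boot all_order all_algebra.
From mathcomp Require Import all_classical all_reals all_analysis.
Set Implicit Arguments.
Unset Strict Implicit.
Unset Printing Implicit Defensive.
Import Order.TTheory GRing.Theory Num.Theory.
Import numFieldNormedType.Exports.
Local Open Scope classical_set_scope.
Local Open Scope ring_scope.

Record sgraph := SGraph {
  vertex :> finType;
  edge : rel vertex;
  edge_sym : symmetric edge;
  edge_irrefl : irreflexive edge }.

Definition edgeless_rel n : rel 'I_n := fun _ _ => false.

Lemma edgeless_sym n : symmetric (@edgeless_rel n).
Proof. by []. Qed.

Lemma edgeless_irrefl n : irreflexive (@edgeless_rel n).
Proof. by []. Qed.

Definition edgeless n : sgraph :=
  SGraph (@edgeless_sym n) (@edgeless_irrefl n).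

Definition disjoint_union_rel (G H : sgraph) : rel (G + H)%type :=
  fun u v => match u, v with
             | inl a, inl b => edge a b
             | inr x, inr y => edge x y
             | _, _ => false
             end.

Lemma disjoint_union_sym (G H : sgraph) : symmetric (@disjoint_union_rel G H).
Proof. by move=> [a|x] [b|y] //=; exact: edge_sym. Qed.

Lemma disjoint_union_irrefl (G H : sgraph) :
  irreflexive (@disjoint_union_rel G H).
Proof. by move=> [a|x] /=; exact: edge_irrefl. Qed.

Definition disjoint_union (G H : sgraph) : sgraph :=
  SGraph (@disjoint_union_sym G H) (@disjoint_union_irrefl G H).

Definition strong_product_rel (G H : sgraph) : rel (G * H)%type :=
  fun u v => [&& u != v,
                 (u.1 == v.1) || edge u.1 v.1 &
                 (u.2 == v.2) || edge u.2 v.2].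

Lemma strong_product_sym (G H : sgraph) : symmetric (@strong_product_rel G H).
Proof.
move=> u v; rewrite /strong_product_rel eq_sym (eq_sym u.1) (eq_sym u.2).
by rewrite (edge_sym u.1) (edge_sym u.2).
Qed.

Lemma strong_product_irrefl (G H : sgraph) :
  irreflexive (@strong_product_rel G H).
Proof. by move=> u; rewrite /strong_product_rel eqxx. Qed.

Definition strong_product (G H : sgraph) : sgraph :=
  SGraph (@strong_product_sym G H) (@strong_product_irrefl G H).

Fixpoint strong_power (G : sgraph) (n : nat) : sgraph :=
  if n is m.+1 then strong_product G (strong_power G m) else edgeless 1.

Definition cohomomorphism (G H : sgraph) (f : G -> H) : Prop :=
  forall u v : G, u != v -> ~~ edge u v ->
    f u != f v /\ ~~ edge (f u) (f v).

Definition cohom_le (G H : sgraph) : Prop :=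
  exists f : G -> H, cohomomorphism f.

Definition independent (G : sgraph) (A : {set G}) : bool :=
  [forall u in A, forall v in A, ~~ edge u v].

Definition alpha (G : sgraph) : nat :=
  \max_(A : {set G} | independent A) #|A|.

(* The residues are computed in [int], where [%%] has values in [0, p). *)
Definition fraction_rel (p q : nat) : rel 'I_p :=
  fun u v => (u != v) &&
    ((((u%:Z - v%:Z) %% p%:Z)%Z < q%:Z) || (((v%:Z - u%:Z) %% p%:Z)%Z < q%:Z)).

Lemma fraction_sym p q : symmetric (@fraction_rel p q).
Proof. by move=> u v; rewrite /fraction_rel eq_sym orbC. Qed.

Lemma fraction_irrefl p q : irreflexive (@fraction_rel p q).
Proof. by move=> u; rewrite /fraction_rel eqxx. Qed.

(* Total in p and q, but only meaningful under [fraction_ge2 p q]. *)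
Definition fraction_graph (p q : nat) : sgraph :=
  SGraph (@fraction_sym p q) (@fraction_irrefl p q).

(* Elements of Q_{>=2} are represented by arbitrary, not necessarily reduced,
   fractions p/q of positive integers. *)
Definition fraction_ge2 (p q : nat) : Prop :=
  [/\ (0 < p)%N, (0 < q)%N & 2 <= p%:Q / q%:Q].

Section Spectrum.
Variable R : realType.
Implicit Types (F : sgraph -> R) (G H : sgraph) (s : R).

Definition alphaR G : R := (alpha G)%:R.

Definition shannon_capacity G : R :=
  limn (fun n : nat => (alpha (strong_power G n))%:R `^ (n%:R^-1) : R).

(* A predicate rather than a [set]: the universe of [set] lies below the one of
   [finType], hence below the one of [sgraph]. *)
Definition asymptotic_spectrum F : Prop :=
  [/\ forall G, 0 <= F G,
      forall G H, F (disjoint_union G H) = F G + F H,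
      forall G H, F (strong_product G H) = F G * F H,
      forall n, F (edgeless n) = n%:R &
      forall G H, cohom_le G H -> F G <= F H].

Definition spectrum_dist G H : R :=
  sup [set x | exists2 F, asymptotic_spectrum F & x = `|F G - F H|].

Definition spectrum_cauchy (G : nat -> sgraph) : Prop :=
  forall e : R, 0 < e ->
    exists N : nat, forall m n, (N <= m)%N -> (N <= n)%N ->
      spectrum_dist (G m) (G n) < e.

Definition sup_below F s : R :=
  sup [set x | exists a b, [/\ fraction_ge2 a b, a%:R / b%:R < s &
                               x = F (fraction_graph a b)]].

Definition inf_above F s : R :=
  inf [set x | exists a b, [/\ fraction_ge2 a b, s < a%:R / b%:R &
                               x = F (fraction_graph a b)]].

End Spectrum.

(* Main.v *)
Require Import Defs.
From mathcomp Require Import all_boot all_order all_algebra.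
From mathcomp Require Import all_classical all_reals all_analysis.
From mathcomp Require Import zify ring lra.
Import Order.TTheory GRing.Theory Num.Theory.
Import numFieldNormedType.Exports.
Set Implicit Arguments.
Unset Strict Implicit.
Unset Printing Implicit Defensive.
Local Open Scope classical_set_scope.
Local Open Scope ring_scope.

(** The function p/q |-> F(E_{p/q}) is nondecreasing, since p/q <= a/b gives a
cohomomorphism u |-> floor (u b / q) ([fraction_graph_le]).  Everything
therefore follows once an irrational r is enclosed between two fractions
p'/q' < r < p/q at which the values of F are arbitrarily close.

Take p'/q' and p/q to be Farey neighbours, p q' = q p' + 1.  The map
u |-> floor (u q' / q), after a small shift, then misses being a
cohomomorphism from E_{p/q} to E_{p'/q'} by a single vertex, and by rotation
that vertex can be any prescribed c ([fraction_graph_puncture]).  A word of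
length n < p over Z/p avoids one of the letters 0, ..., n; announcing an
avoided letter c and then applying the map that is good off c to each
coordinate gives
   E_{p/q}^n <= E_{n+1} * E_{p'/q'}^n
for strong powers ([fraction_graph_power_le]).  Hence
   F(E_{p/q})^n <= (n+1) F(E_{p'/q'})^n
for F in the asymptotic spectrum.  The same inequality holds for the Shannon
capacity, because that is the limit of the n-th roots of alpha (Fekete's
lemma, [fekete], gives the existence of the limit), and for alpha itself,
because a maximum independent set can be rotated off the bad vertex.

As (n+1)^(1/n) tends to 1 ([root_ratio_small]), a fixed large n makes the two
values close; an irrational number has enclosing Farey neighbours with
arbitrarily large p ([farey_neighbours]), so n < p can be met.  The closeness
depends on F only through an upper bound for F near r; every F in the
asymptotic spectrum is at most c on fractions at most c, because E_{c/1} has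
no edges, and this makes the estimate uniform ([small_oscillation]). *)

(** * Cohomomorphisms and strong products *)

(** The form in which non-adjacency is used throughout: cohomomorphisms are the
maps that preserve it, and two pairs have it in a strong product iff one of
their coordinates does. *)
Definition distinguishable (G : sgraph) (u v : G) : bool :=
  (u != v) && ~~ edge u v.

Lemma cohomomorphismP (G H : sgraph) (f : G -> H) :
  cohomomorphism f <->
  forall u v, distinguishable u v -> distinguishable (f u) (f v).
Proof.
split=> h u v; first by case/andP=> uv e; apply/andP; exact: h.
by move=> uv e; apply/andP; apply: h; apply/andP.
Qed.

Lemma distinguishable_prod (G H : sgraph) (u v : strong_product G H) :
  distinguishable u v = distinguishable u.1 v.1 || distinguishable u.2 v.2.
Proof.
case: u v => [a x] [b y].
rewrite /distinguishable /= /strong_product_rel /= xpair_eqE.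
case: (eqVneq a b) => [->|ab]; case: (eqVneq x y) => [->|xy] //=;
  by rewrite ?edge_irrefl ?andbF //= ?orbF ?andbT ?negb_and.
Qed.

Lemma cohom_le_refl (G : sgraph) : cohom_le G G.
Proof. by exists id; apply/cohomomorphismP. Qed.

Lemma cohom_le_trans (G H K : sgraph) :
  cohom_le G H -> cohom_le H K -> cohom_le G K.
Proof.
move=> [f /cohomomorphismP hf] [g /cohomomorphismP hg]; exists (g \o f).
by apply/cohomomorphismP => u v /hf/hg.
Qed.

Lemma cohom_le_prod (G G' H H' : sgraph) : cohom_le G G' -> cohom_le H H' ->
  cohom_le (strong_product G H) (strong_product G' H').
Proof.
move=> [f /cohomomorphismP hf] [g /cohomomorphismP hg].
exists (fun u : strong_product G H => (f u.1, g u.2) : strong_product G' H').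
apply/cohomomorphismP => u v; rewrite !distinguishable_prod /=.
by case/orP=> [/hf|/hg] ->; rewrite ?orbT.
Qed.

Lemma cohom_le_power (G H : sgraph) n : cohom_le G H ->
  cohom_le (strong_power G n) (strong_power H n).
Proof.
by move=> GH; elim: n => [|n IH]; [exact: cohom_le_refl|exact: cohom_le_prod].
Qed.

Lemma cohom_le_prodA (G H K : sgraph) :
  cohom_le (strong_product G (strong_product H K))
           (strong_product (strong_product G H) K).
Proof.
exists (fun u : strong_product G (strong_product H K) =>
  ((u.1, u.2.1), u.2.2) : strong_product (strong_product G H) K).
by apply/cohomomorphismP => u v; rewrite !distinguishable_prod /= orbA.
Qed.

Lemma cohom_le_prodAr (G H K : sgraph) :
  cohom_le (strong_product (strong_product G H) K)
           (strong_product G (strong_product H K)).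
Proof.
exists (fun u : strong_product (strong_product G H) K =>
  (u.1.1, (u.1.2, u.2)) : strong_product G (strong_product H K)).
by apply/cohomomorphismP => u v; rewrite !distinguishable_prod /= orbA.
Qed.

Lemma cohom_le_prodACA (G H K L : sgraph) :
  cohom_le (strong_product (strong_product G H) (strong_product K L))
           (strong_product (strong_product G K) (strong_product H L)).
Proof.
exists (fun u : strong_product (strong_product G H) (strong_product K L) =>
  ((u.1.1, u.2.1), (u.1.2, u.2.2))
    : strong_product (strong_product G K) (strong_product H L)).
by apply/cohomomorphismP => u v; rewrite !distinguishable_prod /= orbACA.
Qed.

Lemma cohom_le_prod1l (G : sgraph) : cohom_le (strong_product (edgeless 1) G) G.
Proof.
exists (fun u : strong_product (edgeless 1) G => u.2).
apply/cohomomorphismP => u v; rewrite distinguishable_prod /= /distinguishable.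
by rewrite (ord1 u.1) (ord1 v.1) eqxx.
Qed.

Lemma cohom_le_prod1r (G : sgraph) : cohom_le G (strong_product (edgeless 1) G).
Proof.
exists (fun u : G => (ord0, u) : strong_product (edgeless 1) G).
by apply/cohomomorphismP => u v uv; rewrite distinguishable_prod /= uv ?orbT.
Qed.

Lemma cohom_le_powerD (G : sgraph) m n :
  cohom_le (strong_power G (m + n))
           (strong_product (strong_power G m) (strong_power G n)).
Proof.
elim: m => [|m IH]; first exact: cohom_le_prod1r.
apply: cohom_le_trans (cohom_le_prodA _ _ _).
exact: cohom_le_prod (cohom_le_refl _) IH.
Qed.

Lemma cohom_le_powerDr (G : sgraph) m n :
  cohom_le (strong_product (strong_power G m) (strong_power G n))
           (strong_power G (m + n)).
Proof.
elim: m => [|m IH]; first exact: cohom_le_prod1l.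
apply: cohom_le_trans (cohom_le_prodAr _ _ _) _.
exact: cohom_le_prod (cohom_le_refl _) IH.
Qed.

(** * Independent sets *)

(** The map need only be good on the independent set itself; this is what lets
a map that is bad at one vertex still bound [alpha]. *)
Lemma leq_card_alpha (G H : sgraph) (A : {set G}) (f : G -> H) :
  independent A ->
  {in A &, forall u v, distinguishable u v -> distinguishable (f u) (f v)} ->
  (#|A| <= alpha H)%N.
Proof.
move=> iA hf.
have sepA u v : u \in A -> v \in A -> u != v -> distinguishable (f u) (f v).
  move=> uA vA uv; apply: hf => //; rewrite /distinguishable uv /=.
  by move/forall_inP: iA => /(_ _ uA)/forall_inP/(_ _ vA).
have fI : {in A &, injective f}.
  move=> u v uA vA fuv; apply/eqP; apply: contraT => uv.
  by have := sepA _ _ uA vA uv; rewrite /distinguishable fuv eqxx.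
rewrite -(card_in_imset fI) /alpha; apply: leq_bigmax_cond.
apply/forall_inP => _ /imsetP[u uA ->]; apply/forall_inP => _ /imsetP[v vA ->].
have [->|/(sepA _ _ uA vA)/andP[]//] := eqVneq u v.
by rewrite edge_irrefl.
Qed.

Lemma alpha_witness (G : sgraph) :
  exists2 A : {set G}, independent A & #|A| = alpha G.
Proof.
have i0 : independent (finset.set0 : {set G}).
  by apply/forall_inP => u; rewrite inE.
rewrite /alpha (bigop.bigmax_eq_arg finset.set0) //.
by case: arg_maxnP => // A iA _; exists A.
Qed.

Lemma alpha_le (G H : sgraph) : cohom_le G H -> (alpha G <= alpha H)%N.
Proof.
move=> [f /cohomomorphismP hf]; have [A iA <-] := alpha_witness G.
by apply: (leq_card_alpha iA (f := f)) => u v _ _; exact: hf.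
Qed.

Lemma alpha_gt0 (G : sgraph) : G -> (0 < alpha G)%N.
Proof.
move=> x; have iA : independent [set x]%SET.
  by apply/forall_inP => u /set1P ->; apply/forall_inP => v /set1P ->;
    rewrite edge_irrefl.
by have := leq_card_alpha (f := id) iA (fun _ _ _ _ h => h); rewrite cards1.
Qed.

Lemma alpha_prod_ge (G H : sgraph) :
  (alpha G * alpha H <= alpha (strong_product G H))%N.
Proof.
have [A iA <-] := alpha_witness G; have [B iB <-] := alpha_witness H.
rewrite -cardsX; apply: (leq_card_alpha (G := strong_product G H) (f := id)) => //.
apply/forall_inP => u; rewrite finset.inE => /andP[u1 u2].
apply/forall_inP => v; rewrite finset.inE => /andP[v1 v2].
have hA := forall_inP (forall_inP iA _ u1) _ v1.
have hB := forall_inP (forall_inP iB _ u2) _ v2.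
rewrite /= /strong_product_rel (negbTE hA) (negbTE hB) !orbF.
by case: u v {u1 u2 v1 v2 hA hB} => a x [b y]; rewrite xpair_eqE; do 2!case: eqP.
Qed.

(** An independent set splits into fibres over the first coordinate, and two
elements of one fibre can only be distinguished by the second coordinate. *)
Lemma alpha_prod_le (G H : sgraph) :
  (alpha (strong_product G H) <= #|G| * alpha H)%N.
Proof.
have [A iA <-] := alpha_witness (strong_product G H).
rewrite -sum1_card (partition_big (fun u : G * H => u.1) predT) //=.
rewrite -sum_nat_const; apply: leq_sum => a _.
rewrite sum1dep_card.
pose B : {set strong_product G H} := [set u | (u \in A) && (u.1 == a)]%SET.
apply: (leq_card_alpha (A := B) (f := fun u : strong_product G H => u.2)).
  apply/forall_inP => u; rewrite inE => /andP[uA _]; apply/forall_inP => v.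
  by rewrite inE => /andP[vA _]; exact: (forall_inP (forall_inP iA _ uA)).
move=> u v; rewrite !inE => /andP[_ /eqP u1] /andP[_ /eqP v1].
by rewrite distinguishable_prod u1 v1 /distinguishable eqxx.
Qed.

(** * Covering a strong power *)

Lemma card_power (G : sgraph) n : #|strong_power G n| = (#|G| ^ n)%N.
Proof. by elim: n => [|n IH]; rewrite ?card_ord // card_prod IH expnS. Qed.

Fixpoint coords (G : sgraph) n : strong_power G n -> seq G :=
  if n is m.+1 return strong_power G n -> seq G
  then fun u => u.1 :: coords u.2 else fun=> [::].

Lemma size_coords (G : sgraph) n (u : strong_power G n) : size (coords u) = n.
Proof. by elim: n u => //= n IH u; rewrite IH. Qed.

Fixpoint power_map (G H : sgraph) (f : G -> H) n :
    strong_power G n -> strong_power H n :=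
  if n is m.+1 return strong_power G n -> strong_power H n
  then fun u => (f u.1, power_map f u.2) else id.

Lemma distinguishable_power_map (G H : sgraph) (f : G -> H) (P : pred G) n
    (u v : strong_power G n) :
  {in P &, forall x y, distinguishable x y -> distinguishable (f x) (f y)} ->
  all P (coords u) -> all P (coords v) ->
  distinguishable u v -> distinguishable (power_map f u) (power_map f v).
Proof.
move=> hf; elim: n u v => [//|n IH] u v /= /andP[Pu Pus] /andP[Pv Pvs].
rewrite !distinguishable_prod /= => /orP[h|h]; first by rewrite hf.
by rewrite [X in _ || X]IH ?orbT.
Qed.

(** A word of length n misses one of n + 1 distinct letters.  Words with
different announced letters are separated by the edgeless factor, so only
words that miss the same letter have to be separated by the maps. *)
Lemma power_cover (G H : sgraph) n (c : 'I_n.+1 -> G) (f : 'I_n.+1 -> G -> H) :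
  injective c ->
  (forall i, {in predC1 (c i) &, forall x y,
     distinguishable x y -> distinguishable (f i x) (f i y)}) ->
  cohom_le (strong_power G n)
           (strong_product (edgeless n.+1) (strong_power H n)).
Proof.
move=> cI hf.
have avoid (u : strong_power G n) : exists i, c i \notin coords u.
  apply/existsP; apply: contraT; rewrite negb_exists => /forallP h.
  have := @uniq_leq_size _ (map c (enum 'I_n.+1)) (coords u).
  rewrite (map_inj_uniq cI) enum_uniq size_map size_coords size_enum_ord ltnn.
  apply=> //.
  by move=> _ /mapP[i _ ->]; have := h i; rewrite negbK.
pose m u := xchoose (avoid u).
exists (fun u => (m u, power_map (f (m u)) u)
  : strong_product (edgeless n.+1) (strong_power H n)).
apply/cohomomorphismP => u v uv; rewrite distinguishable_prod /=.
have [mE|mN] := eqVneq (m u) (m v); last by rewrite /distinguishable mN.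
have all_neq w : all (predC1 (c (m w))) (coords w).
  apply/allP => x xw; apply: contraNneq (xchooseP (avoid w)) => <-.
  by [].
rewrite mE [X in _ || X](distinguishable_power_map (hf (m v))) ?orbT //.
by rewrite -mE.
Qed.

(** * Fraction graphs *)

Lemma fraction_ge2P p q :
  fraction_ge2 p q <-> [/\ (0 < p)%N, (0 < q)%N & (2 * q <= p)%N].
Proof.
have E : (0 < q)%N -> (2 <= p%:Q / q%:Q :> rat) = (2 * q <= p)%N.
  move=> q0; rewrite ler_pdivlMr ?ltr0n // -[2%:R]/(2%:~R) -intrM ler_int.
  by lia.
by split=> -[p0 q0 h]; split=> //; move: h; rewrite E.
Qed.

(** For d = |u - v| the circular distance from u to v on a cycle of length p is
min (d, p - d); it has to be at least q.  With truncated subtraction one of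
u - v and v - u is 0, which is never far when q is positive. *)
Definition circ_far p q (d : nat) : bool := (q <= d)%N && (d + q <= p)%N.

Lemma distinguishable_fraction p q (u v : 'I_p) : (0 < q)%N ->
  @distinguishable (fraction_graph p q) u v =
    circ_far p q (u - v)%N || circ_far p q (v - u)%N.
Proof.
move=> q0.
have half (i j : nat) : (j < i < p)%N ->
    (((i%:Z - j%:Z) %% p%:Z)%Z < q%:Z) || (((j%:Z - i%:Z) %% p%:Z)%Z < q%:Z)
    = ~~ circ_far p q (i - j)%N.
  move=> /andP[ji ip].
  have -> : ((i%:Z - j%:Z) %% p%:Z)%Z = (i - j)%N%:Z.
    by rewrite modz_small; lia.
  have -> : ((j%:Z - i%:Z) %% p%:Z)%Z = (p - (i - j))%N%:Z.
    have -> : j%:Z - i%:Z = (-1) * p%:Z + (p - (i - j))%N%:Z by lia.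
    by rewrite modzMDl modz_small; lia.
  by rewrite /circ_far; lia.
rewrite /distinguishable /= /fraction_rel.
have := ltn_ord u; have := ltn_ord v; rewrite -val_eqE /=.
case: (ltngtP u v) => uv hv hu /=; rewrite ?eqxx /=.
- by rewrite orbC half ?uv // negbK /circ_far; lia.
- by rewrite half ?uv // negbK /circ_far; lia.
- by rewrite uv /circ_far; lia.
Qed.

(** The cohomomorphism is u |-> floor (u b / q). *)
Lemma fraction_graph_le p q a b : (0 < q)%N -> (0 < b)%N ->
  (p * b <= a * q)%N -> cohom_le (fraction_graph p q) (fraction_graph a b).
Proof.
move=> q0 b0 pa.
have range (u : 'I_p) : (u * b %/ q < a)%N.
  by rewrite ltn_divLR // (leq_trans _ pa) // ltn_pmul2r.
exists (fun u : 'I_p => Ordinal (range u)).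
apply/cohomomorphismP => u v; rewrite !distinguishable_fraction //=.
have half (i j : nat) : circ_far p q (i - j)%N ->
    circ_far a b (i * b %/ q - j * b %/ q)%N.
  move=> /andP[qd dp].
  have := divn_eq (i * b) q; have := divn_eq (j * b) q.
  have := ltn_pmod (i * b) q0; have := ltn_pmod (j * b) q0.
  set x := (i * b %/ q)%N; set y := (j * b %/ q)%N.
  set s := (_ %% q)%N; set t := (_ %% q)%N => hs ht Ej Ei.
  have h1 : (j * b + q * b <= i * b)%N.
    by rewrite -mulnDl leq_mul2r; apply/orP; right; lia.
  have h2 : (i * b + q * b <= j * b + p * b)%N.
    by rewrite -!mulnDl leq_mul2r; apply/orP; right; lia.
  have low : (y + b <= x)%N.
    rewrite leqNgt; apply/negP => lt.
    have : ((x + 1) * q <= (y + b) * q)%N by rewrite leq_mul2r; lia.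
    by rewrite !mulnDl (mulnC b q); lia.
  apply/andP; split; first by lia.
  rewrite leqNgt; apply/negP => lt.
  have : ((a + 1 + y) * q <= (x + b) * q)%N.
    by rewrite leq_mul2r; apply/orP; right; lia.
  by rewrite !mulnDl (mulnC b q); lia.
by case/orP => /half ->; rewrite ?orbT.
Qed.

(** The residue of u - c modulo p, without division so that linear arithmetic
applies. *)
Definition rotate p (c u : nat) : nat :=
  (if c <= u then u - c else u + p - c)%N.

(** Rotate c to 0 and send w > 0 to floor ((w q' - 1) / q).  Since
p q' / q = p' + 1 / q, scaling by q' / q stretches the circumference by only
1 / q too much.  This can break the upper bound on a difference only if
the two positions differ by exactly p - q and, because of the shift by -1, the
smaller one, w, makes w q' a multiple of q.  Then q divides w, so w >= q, and
the larger position w + p - q would leave the range. *)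
Lemma fraction_graph_puncture p q p' q' (c : 'I_p) :
  (0 < q)%N -> (0 < p')%N -> (0 < q')%N -> (p * q' = q * p' + 1)%N ->
  exists f : fraction_graph p q -> fraction_graph p' q',
    {in predC1 c &, forall u v,
      distinguishable u v -> distinguishable (f u) (f v)}.
Proof.
move=> q0 p'0 q'0 E.
pose g w := ((w * q').-1 %/ q)%N.
have rot_lt (u : 'I_p) : (rotate p c u < p)%N.
  by rewrite /rotate; have := ltn_ord u; have := ltn_ord c; case: ifP; lia.
have range (u : 'I_p) : (g (rotate p c u) < p')%N.
  rewrite ltn_divLR //; have := rot_lt u; set w := rotate _ _ _ => wp.
  have : (w.+1 * q' <= p * q')%N by rewrite leq_mul2r wp orbT.
  have : (0 < q * p')%N by rewrite muln_gt0 q0.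
  by rewrite mulSn E (mulnC p'); lia.
exists (fun u : 'I_p => Ordinal (range u)) => u v uc vc.
rewrite !distinguishable_fraction //=.
have rot0 (w : 'I_p) : w \in predC1 c -> (0 < rotate p c w)%N.
  rewrite inE -val_eqE /= /rotate; have := ltn_ord w; have := ltn_ord c.
  by case: ifP; lia.
have far_rot : circ_far p q (u - v)%N || circ_far p q (v - u)%N =
    circ_far p q (rotate p c u - rotate p c v)%N ||
    circ_far p q (rotate p c v - rotate p c u)%N.
  rewrite /circ_far /rotate; have := ltn_ord c.
  by have := ltn_ord u; have := ltn_ord v; do 2!case: ifP; lia.
have half (i j : nat) : (i < p)%N -> (0 < j)%N -> circ_far p q (i - j)%N ->
    circ_far p' q' (g i - g j)%N.
  move=> ip j0 /andP[qd dp]; rewrite /g.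
  have ji : (j < i)%N by lia.
  have := divn_eq (i * q').-1 q; have := divn_eq (j * q').-1 q.
  have := ltn_pmod (i * q').-1 q0; have := ltn_pmod (j * q').-1 q0.
  set x := ((i * q').-1 %/ q)%N; set y := ((j * q').-1 %/ q)%N.
  set s := (_ %% q)%N; set t := (_ %% q)%N => hs ht Ej Ei.
  have pj : (0 < j * q')%N by rewrite muln_gt0 j0.
  have pi : (0 < i * q')%N by rewrite muln_gt0 q'0 (leq_trans _ ji).
  have Ej' : (j * q' = y * q + s + 1)%N by lia.
  have Ei' : (i * q' = x * q + t + 1)%N by lia.
  have h1 : (j * q' + q * q' <= i * q')%N.
    by rewrite -mulnDl leq_mul2r; apply/orP; right; lia.
  have h2 : (i * q' + q * q' <= j * q' + p * q')%N.
    by rewrite -!mulnDl leq_mul2r; apply/orP; right; lia.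
  have low : (y + q' <= x)%N.
    rewrite leqNgt; apply/negP => lt.
    have : ((x + 1) * q <= (y + q') * q)%N by rewrite leq_mul2r; lia.
    by rewrite !mulnDl (mulnC q' q); lia.
  apply/andP; split; first by lia.
  have [//|bad] := leqP (x - y + q')%N p'.
  have key : ((p' + 1 + y) * q <= (x + q') * q)%N.
    by rewrite leq_mul2r; apply/orP; right; lia.
  rewrite !mulnDl (mulnC p') (mulnC q' q) in key.
  (* A failure of the upper bound makes all the inequalities tight. *)
  have gap : (i + q = j + p)%N.
    apply/eqP; rewrite eqn_leq; apply/andP; split; first by lia.
    rewrite leqNgt; apply/negP => lt.
    have : ((i + q + 1) * q' <= (j + p) * q')%N.
      by rewrite leq_mul2r; lia.
    by rewrite !mulnDl; lia.
  have sq : (s + 1 = q)%N by lia.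
  have qj : (q %| j)%N.
    have cqq : coprime q q'.
      by rewrite coprime_sym; apply/coprimeP => //; exists (p, p') => /=; lia.
    by rewrite -(Gauss_dvdl _ cqq) Ej' -addnA sq; apply/dvdnP; exists y.+1; lia.
  by have := dvdn_leq j0 qj; lia.
rewrite far_rot => /orP[h|h]; first by rewrite (half _ _ (rot_lt u) (rot0 _ vc) h).
by rewrite (half _ _ (rot_lt v) (rot0 _ uc) h) orbT.
Qed.

Lemma fraction_graph_power_le p q p' q' n : (n < p)%N ->
  (0 < q)%N -> (0 < p')%N -> (0 < q')%N -> (p * q' = q * p' + 1)%N ->
  cohom_le (strong_power (fraction_graph p q) n)
    (strong_product (edgeless n.+1) (strong_power (fraction_graph p' q') n)).
Proof.
move=> np q0 p'0 q'0 E.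
have [f hf] := choice (fun c : 'I_p => fraction_graph_puncture c q0 p'0 q'0 E).
apply: (@power_cover (fraction_graph p q) _ n (widen_ord np)
  (fun i => f (widen_ord np i))) => [i j /(congr1 val) ij|i].
  exact/val_inj.
exact: hf.
Qed.

(** As 1 < q, the vertices 0 and 1 are adjacent, so a maximum independent set
misses some vertex c, and the map that is good off c is good on it. *)
Lemma alpha_fraction_graph_le p q p' q' : (1 < q < p)%N ->
  (0 < p')%N -> (0 < q')%N -> (p * q' = q * p' + 1)%N ->
  (alpha (fraction_graph p q) <= alpha (fraction_graph p' q'))%N.
Proof.
move=> /andP[q1 qp] p'0 q'0 E.
have [A iA <-] := alpha_witness (fraction_graph p q).
have [c cA] : exists c : 'I_p, c \notin A.
  have p1 : (1 < p)%N by lia.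
  pose x0 : 'I_p := Ordinal (ltnW p1); pose x1 : 'I_p := Ordinal p1.
  have [x0A|] := boolP (x0 \in A); last by exists x0.
  have [x1A|] := boolP (x1 \in A); last by exists x1.
  have := forall_inP (forall_inP iA _ x0A) _ x1A.
  have : ~~ @distinguishable (fraction_graph p q) x0 x1.
    by rewrite distinguishable_fraction /circ_far /=; lia.
  by rewrite /distinguishable => + ne; rewrite ne.
have [f hf] := fraction_graph_puncture c (ltnW q1) p'0 q'0 E.
apply: (leq_card_alpha iA (f := f)) => u v uA vA; apply: hf.
  by rewrite inE; apply: contraNneq cA => <-.
by rewrite inE; apply: contraNneq cA => <-.
Qed.

(** * Shannon capacity *)

Section Fekete.
Context {R : realType}.
Variables (a : nat -> R) (B : R).
Hypothesis a_ge0 : forall n, 0 <= a n.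
Hypothesis aD : forall m n, a m + a n <= a (m + n)%N.
Hypothesis aB : forall n, a n <= n%:R * B.

Definition growth_rate : R :=
  sup [set x | exists2 n, (0 < n)%N & x = a n / n%:R].

Lemma growth_rate_has_sup :
  has_sup [set x | exists2 n, (0 < n)%N & x = a n / n%:R].
Proof.
split; first by exists (a 1 / 1%:R); exists 1%N.
by exists B => _ [n n0 ->]; rewrite ler_pdivrMr ?ltr0n // mulrC aB.
Qed.

Lemma le_growth_rate n : a n <= n%:R * growth_rate.
Proof.
case: n => [|n]; first by rewrite mul0r; have := aB 0; rewrite mul0r.
rewrite mulrC -ler_pdivrMr ?ltr0n //; apply: sup_upper_bound.
  exact: growth_rate_has_sup.
by exists n.+1.
Qed.

Lemma growth_rate_le x : (forall n, (0 < n)%N -> a n <= n%:R * x) ->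
  growth_rate <= x.
Proof.
move=> h; apply: ge_sup; first by case: growth_rate_has_sup.
by move=> _ [n n0 ->]; rewrite ler_pdivrMr ?ltr0n // mulrC h.
Qed.

(** Writing n = k m + l gives a n >= k * a m, whence a n / n is at least
a m / m - a m / n; choose first m with a m / m close to the supremum, then n
large. *)
Lemma fekete : a n / n%:R @[n --> \oo] --> growth_rate.
Proof.
apply/cvgrPdist_le => e e0.
have e20 : 0 < e / 2 by rewrite divr_gt0.
have [_ [m m0 ->] hm] := sup_adherent e20 growth_rate_has_sup.
have aM k : k%:R * a m <= a (k * m)%N.
  elim: k => [|k IH]; first by rewrite mul0r.
  by rewrite mulSn -natr1 mulrDl mul1r addrC; apply: le_trans (aD _ _); rewrite lerD2l.
exists (Num.Def.trunc (a m / (e / 2))).+1 => // n /= hn.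
have n0 : (0 < n)%N by apply: leq_trans hn.
have nR : 0 < n%:R :> R by rewrite ltr0n.
have mR : 0 < m%:R :> R by rewrite ltr0n.
have small : a m / n%:R <= e / 2.
  rewrite ler_pdivrMr // mulrC -ler_pdivrMr //.
  by apply/ltW/(lt_le_trans (truncnS_gt _)); rewrite ler_nat.
have le1 : a n / n%:R <= growth_rate.
  by rewrite ler_pdivrMr // mulrC le_growth_rate.
rewrite ger0_norm ?subr_ge0 //.
suff : a m / m%:R - a m / n%:R <= a n / n%:R.
  by move: hm; rewrite -/growth_rate; lra.
have k1 : (n%/m)%:R * a m <= a n.
  rewrite {2}(divn_eq n m); apply: le_trans (aM _) _; apply: le_trans (aD _ _).
  by rewrite lerDl.
have k2 : n%:R <= ((n %/ m)%:R + 1) * m%:R :> R.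
  rewrite natr1 -natrM ler_nat; apply: ltnW.
  by rewrite mulSn addnC {1}(divn_eq n m) ltn_add2l ltn_pmod.
rewrite lerBlDr -mulrDl ler_pdivrMr // mulrAC ler_pdivlMr //.
rewrite (mulrC (a m)); apply: le_trans (_ : ((n %/ m)%:R + 1) * m%:R * a m <= _).
  by rewrite ler_wpM2r.
by rewrite mulrAC ler_wpM2r ?ler0n // mulrDl mul1r lerD2r.
Qed.

End Fekete.

Lemma alpha_powerD (G : sgraph) m n :
  (alpha (strong_power G m) * alpha (strong_power G n) <=
   alpha (strong_power G (m + n)))%N.
Proof.
exact: leq_trans (alpha_prod_ge _ _) (alpha_le (cohom_le_powerDr _ _ _)).
Qed.

Lemma alpha_power_ge (G : sgraph) m n :
  (alpha (strong_power G m) ^ n <= alpha (strong_power G (m * n)))%N.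
Proof.
elim: n => [|n IH]; first by rewrite muln0; apply: alpha_gt0; exact: ord0.
by rewrite expnS mulnS; apply: leq_trans (alpha_powerD _ _ _); rewrite leq_mul2l IH orbT.
Qed.

Lemma alpha_power_gt0 (G : sgraph) n : G -> (0 < alpha (strong_power G n))%N.
Proof.
move=> x; apply: leq_trans (_ : alpha (strong_power G 1) ^ n <= _)%N; last first.
  by have := alpha_power_ge G 1 n; rewrite mul1n.
by rewrite expn_gt0 (alpha_gt0 ((x, ord0) : strong_power G 1)).
Qed.

Lemma alpha_power_le_card (G : sgraph) n :
  (alpha (strong_power G n) <= #|G| ^ n)%N.
Proof.
rewrite -card_power; have [A _ <-] := alpha_witness (strong_power G n).
exact: max_card.
Qed.

(** The k-th power of the hypothesis; independent sets then lose at most a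
factor #|K| ^ k. *)
Lemma alpha_power_prod_le (G H K : sgraph) n k :
  cohom_le (strong_power G n) (strong_product K (strong_power H n)) ->
  (alpha (strong_power G (k * n)) <=
   #|K| ^ k * alpha (strong_power H (k * n)))%N.
Proof.
move=> h; suff /alpha_le : cohom_le (strong_power G (k * n))
    (strong_product (strong_power K k) (strong_power H (k * n))).
  by move/leq_trans; apply; rewrite -card_power alpha_prod_le.
elim: k => [|k IH]; first exact: cohom_le_prod1r.
rewrite mulSn; apply: cohom_le_trans (cohom_le_powerD _ _ _) _.
apply: cohom_le_trans (cohom_le_prod h IH) _.
apply: cohom_le_trans (cohom_le_prodACA _ _ _ _) _.
exact: cohom_le_prod (cohom_le_refl _) (cohom_le_powerDr _ _ _).
Qed.

Section Capacity.
Context {R : realType}.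

Definition log_alpha (G : sgraph) n : R := ln (alpha (strong_power G n))%:R.

Section Nonempty.
Variables (G : sgraph) (x : G).

Let alphaG_pos n : (alpha (strong_power G n))%:R \is @Num.pos R.
Proof. by rewrite posrE ltr0n alpha_power_gt0. Qed.

Lemma log_alpha_ge0 n : 0 <= log_alpha G n.
Proof. by apply: ln_ge0; rewrite ler1n alpha_power_gt0. Qed.

Lemma log_alphaD m n : log_alpha G m + log_alpha G n <= log_alpha G (m + n).
Proof.
by rewrite /log_alpha -lnM // -natrM ler_ln ?ler_nat ?alpha_powerD // posrE
  ltr0n muln_gt0 !alpha_power_gt0.
Qed.

Lemma log_alpha_le n : log_alpha G n <= n%:R * ln #|G|%:R.
Proof.
have G0 : (0 < #|G|)%N by apply/card_gt0P; exists x.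
rewrite mulr_natl -lnXn ?ltr0n // -natrX /log_alpha ler_ln // ?ler_nat.
  exact: alpha_power_le_card.
by rewrite posrE ltr0n expn_gt0 G0.
Qed.

Lemma shannon_capacityE :
  shannon_capacity R G = expR (growth_rate (log_alpha G)).
Proof.
apply/cvg_lim => //.
have -> : (fun n : nat => (alpha (strong_power G n))%:R `^ n%:R^-1 : R) =
    (fun n => expR (log_alpha G n / n%:R)).
  apply/funext => n; rewrite /powR (gt_eqF (alphaG_pos n)) /log_alpha.
  by rewrite mulrC.
apply: continuous_cvg; first exact: continuous_expR.
exact: fekete log_alpha_ge0 log_alphaD log_alpha_le.
Qed.

End Nonempty.

(** Dividing the logarithm of the hypothesis by k and taking the supremum over k
turns it into the inequality of growth rates. *)
Lemma shannon_capacity_compare (G H : sgraph) c n : G -> H ->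
  (0 < c)%N -> (0 < n)%N ->
  (forall k, (alpha (strong_power G k) ^ n <=
              c ^ k * alpha (strong_power H (k * n)))%N) ->
  shannon_capacity R G ^+ n <= c%:R * shannon_capacity R H ^+ n.
Proof.
move=> x y c0 n0 h; rewrite (shannon_capacityE x) (shannon_capacityE y).
have nR : 0 < n%:R :> R by rewrite ltr0n.
have cR : 0 < c%:R :> R by rewrite ltr0n.
rewrite -!expRM_natl -{1}(lnK cR) -expRD ler_expR -ler_pdivlMl //.
apply: (growth_rate_le (log_alpha_le x)) => k k0.
have kR : 0 < k%:R :> R by rewrite ltr0n.
have := le_growth_rate (log_alpha_le y) (k * n); rewrite natrM => hH.
have : n%:R * log_alpha G k <= k%:R * ln c%:R + log_alpha H (k * n).
  rewrite /log_alpha !mulr_natl -!lnXn ?ltr0n ?alpha_power_gt0 //.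
  rewrite -lnM ?posrE ?ltr0n ?alpha_power_gt0 ?exprn_gt0 ?ltr0n //.
  rewrite -!natrX -natrM ler_ln ?posrE ?ltr0n ?muln_gt0 ?expn_gt0 ?c0 ?alpha_power_gt0 //.
  by rewrite ler_nat.
move=> hG; rewrite -(ler_pM2l nR) (le_trans hG) // (le_trans (lerD (lexx _) hH)) //.
by rewrite mulrCA mulVKf ?gt_eqF // mulrDr mulrA.
Qed.

Lemma shannon_capacity_le (G H : sgraph) : G -> H -> cohom_le G H ->
  shannon_capacity R G <= shannon_capacity R H.
Proof.
move=> x y GH; rewrite -[leRHS]mul1r.
apply: (@shannon_capacity_compare G H 1 1) => // k.
by rewrite exp1n mul1n muln1 expn1; apply/alpha_le/cohom_le_power.
Qed.

Lemma shannon_capacity_power_le (G H : sgraph) m n : G -> H ->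
  (0 < m)%N -> (0 < n)%N ->
  cohom_le (strong_power G n) (strong_product (edgeless m) (strong_power H n)) ->
  shannon_capacity R G ^+ n <= m%:R * shannon_capacity R H ^+ n.
Proof.
move=> x y m0 n0 h; apply: shannon_capacity_compare => // k.
apply: leq_trans (alpha_power_ge _ _ _) _.
by have := alpha_power_prod_le k h; rewrite card_ord.
Qed.

End Capacity.

(** * Rational approximation of an irrational number *)

Section Approximation.
Context {R : realType}.
Implicit Types (r s x y : R).

Lemma irrational_neq r (a b : nat) : irrational r -> (0 < b)%N ->
  r * b%:R != a%:R.
Proof.
move=> irr b0; apply/eqP => E; apply: irr; apply/rationalP.
by exists a%:Z, b; rewrite -pmulrn -E mulfK // pnatr_eq0 -lt0n.
Qed.

Lemma fraction_ge2_above r (p q : nat) : 2 <= r -> (0 < q)%N ->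
  r * q%:R < p%:R -> fraction_ge2 p q.
Proof.
move=> r2 q0 h; have : (2 * q)%:R < p%:R :> R.
  by rewrite natrM; apply: le_lt_trans h; rewrite ler_wpM2r.
by rewrite ltr_nat => pq; apply/fraction_ge2P; split=> //; lia.
Qed.

(** Walking down the Stern-Brocot tree towards r, starting from the integers
around r.  One step adds p/q to p'/q' by mediants as long as the result stays
below r; the first mediant that exceeds r is the new upper neighbour.  Thus
every step changes the upper neighbour and increases its denominator, and the
upper neighbours stay below the integer they start from. *)
Lemma farey_neighbours r N : 2 <= r -> irrational r ->
  exists p q p' q', [/\ fraction_ge2 p' q', (p * q' = q * p' + 1)%N,
    p'%:R < r * q'%:R /\ r * q%:R < p%:R, (N < q)%N &
    (p <= (Num.Def.trunc r).+1 * q)%N].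
Proof.
move=> r2 irr; have r0 : 0 <= r by lra.
elim: N => [|N [p [q [p' [q' [/fraction_ge2P[p'0 q'0 ge2] E [lo hi] Nq pc]]]]]].
  exists (Num.Def.trunc r).+1, 1%N, (Num.Def.trunc r), 1%N.
  have /andP[t1 t2] := truncn_itv r0.
  have tr2 : (2 <= Num.Def.trunc r)%N by rewrite truncn_ge_nat.
  split; rewrite ?muln1 ?mul1n ?mulr1 ?addn1 //.
    by apply/fraction_ge2P; split=> //; lia.
  split=> //; rewrite lt_neqAle t1 andbT eq_sym -[r]mulr1.
  exact: irrational_neq irr (ltn0Sn 0).
pose P k := r * (q' + k.+1 * q)%:R < (p' + k.+1 * p)%:R.
have exP : exists k, P k.
  have d0 : 0 < p%:R - r * q%:R by rewrite subr_gt0.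
  exists (Num.Def.trunc ((r * q'%:R - p'%:R) / (p%:R - r * q%:R))).
  have := truncnS_gt ((r * q'%:R - p'%:R) / (p%:R - r * q%:R)).
  by rewrite ltr_pdivrMr // /P !natrD !natrM; nra.
have [k Pk kmin] := ex_minnP exP.
exists (p' + k.+1 * p)%N, (q' + k.+1 * q)%N, (p' + k * p)%N, (q' + k * q)%N.
have /fraction_ge2P[_ _ pq] : fraction_ge2 p q.
  by apply: fraction_ge2_above hi => //; lia.
split.
- apply/fraction_ge2P; split; [lia|lia|].
  by rewrite mulnDr leq_add // mulnCA leq_mul2l pq orbT.
- by rewrite !mulSn; nia.
- split=> //.
  case: k kmin {Pk} => [|k] kmin; first by rewrite !mul0n !addn0.
  rewrite lt_neqAle eq_sym irrational_neq //; last by lia.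
  by rewrite leNgt; apply/negP => /kmin; rewrite ltnn.
- by rewrite mulSn; nia.
- have : (p' <= (Num.Def.trunc r).+1 * q')%N.
    have : p'%:R < ((Num.Def.trunc r).+1 * q')%:R :> R.
      rewrite natrM; apply: lt_le_trans lo _; rewrite ler_wpM2r //.
      exact/ltW/truncnS_gt.
    by rewrite ltr_nat => /ltnW.
  move=> h; rewrite mulnDr leq_add // mulnCA leq_mul2l.
  by rewrite (leq_trans pc).
Qed.

(** This is the convergence of (n+1)^(1/n) to 1, stated without roots.  For
n = 2 k Bernoulli's inequality gives
(1 + eta)^n >= (1 + k eta)^2 > 1 + k^2 eta^2, which exceeds n + 1 as soon as
k eta^2 > 2. *)
Lemma root_ratio_small (eta : R) : 0 < eta ->
  exists2 n, (0 < n)%N & forall x y, 0 <= x -> 0 <= y ->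
    x ^+ n <= n.+1%:R * y ^+ n -> x <= (1 + eta) * y.
Proof.
move=> eta0; have h0 : 0 <= 1 + eta by lra.
pose k := (Num.Def.trunc (2 / eta ^+ 2)).+1.
have keta : 2 < k%:R * eta ^+ 2.
  by rewrite -ltr_pdivrMr ?exprn_gt0 // truncnS_gt.
have bern : forall m, 1 + m%:R * eta <= (1 + eta) ^+ m.
  elim=> [|m IH]; first by rewrite mul0r addr0 expr0.
  rewrite exprS -natr1; apply: le_trans (ler_wpM2l h0 IH).
  by have : 0 <= m%:R :> R by []; nra.
have grow : (2 * k).+1%:R < (1 + eta) ^+ (2 * k).
  rewrite mulnC exprM expr2 -natr1 natrM.
  have k1 : 1 <= k%:R :> R by rewrite ler1n.
  have X : 1 + k%:R * eta <= (1 + eta) ^+ k := bern k.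
  have keta0 : 0 <= k%:R * eta by rewrite mulr_ge0 // ltW.
  have X2 : (1 + k%:R * eta) ^+ 2 <= (1 + eta) ^+ k * (1 + eta) ^+ k.
    by rewrite -expr2 lerXn2r ?nnegrE ?(addr_ge0 ler01) ?exprn_ge0.
  apply: lt_le_trans X2; rewrite sqrrD expr1n mul1r exprMn expr2 -mulrA.
  have : k%:R * 2 < k%:R * (k%:R * eta ^+ 2) by rewrite ltr_pM2l // ltr0n.
  by rewrite -mulr_natl; lra.
exists (2 * k)%N; first by rewrite muln_gt0.
move=> x y x0 y0 h; rewrite leNgt; apply/negP => lt.
have n0 : (0 < 2 * k)%N by rewrite muln_gt0.
have := lt; rewrite -(ltr_pXn2r n0) ?nnegrE ?mulr_ge0 // exprMn => lt'.
have [yE|yN] := eqVneq y 0.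
  move: h lt; rewrite yE expr0n gtn_eqF // !mulr0 => h /(exprn_gt0 (2 * k)).
  by rewrite ltNge h.
have yp : 0 < y ^+ (2 * k) by rewrite exprn_gt0 // lt_neqAle eq_sym yN.
by have := lt_le_trans lt' h; rewrite ltr_pM2r // ltNge (ltW grow).
Qed.

End Approximation.

(** * Graph parameters that are monotone and regular on fraction graphs *)

Section Regular.
Context {R : realType}.
Implicit Types (F : sgraph -> R) (r s : R).

(** The properties shared by the spectrum, [alpha] and the Shannon capacity from
which continuity follows: monotonicity, and the inequality that the covering
of powers gives for Farey neighbours. *)
Definition fraction_regular F : Prop :=
  [/\ forall p q, fraction_ge2 p q -> 0 <= F (fraction_graph p q),
      forall p q a b, fraction_ge2 p q -> fraction_ge2 a b ->
        cohom_le (fraction_graph p q) (fraction_graph a b) ->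
        F (fraction_graph p q) <= F (fraction_graph a b) &
      forall p q p' q' n, fraction_ge2 p q -> fraction_ge2 p' q' ->
        (p * q' = q * p' + 1)%N -> (1 < q)%N -> (0 < n < p)%N ->
        F (fraction_graph p q) ^+ n <= n.+1%:R * F (fraction_graph p' q') ^+ n].

Lemma spectrum_power F (G : sgraph) n : asymptotic_spectrum F ->
  F (strong_power G n) = F G ^+ n.
Proof.
case=> _ _ FM FE _; elim: n => [|n IH]; first by rewrite FE.
by rewrite FM IH exprS.
Qed.

Lemma fraction_regular_spectrum F : asymptotic_spectrum F -> fraction_regular F.
Proof.
move=> sF; have [F0 _ FM FE Fle] := sF; split=> [*|*|]; [exact: F0|exact: Fle|].
move=> p q p' q' n /fraction_ge2P[_ q0 _] /fraction_ge2P[p'0 q'0 _] E _ /andP[_ np].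
have := Fle _ _ (fraction_graph_power_le np q0 p'0 q'0 E).
by rewrite FM FE !spectrum_power.
Qed.

Lemma fraction_regular_alpha : fraction_regular (@alphaR R).
Proof.
split=> [p q _|p q a b _ _ /alpha_le|p q p' q' n]; rewrite /alphaR ?ler_nat //.
move=> /fraction_ge2P[_ q0 qp] /fraction_ge2P[p'0 q'0 _] E q1 _.
have le : (alpha (fraction_graph p q) <= alpha (fraction_graph p' q'))%N.
  by apply: alpha_fraction_graph_le => //; lia.
apply: le_trans (_ : (alpha (fraction_graph p' q'))%:R ^+ n <= _).
  by rewrite lerXn2r ?nnegrE // ler_nat.
by rewrite ler_peMl ?exprn_ge0 // ler1n.
Qed.

Lemma fraction_regular_shannon : fraction_regular (@shannon_capacity R).
Proof.
have pt p q : fraction_ge2 p q -> fraction_graph p q.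
  by move=> h; have /fraction_ge2P[p0 _ _] := h; exact: (Ordinal p0).
split.
- by move=> p q /pt x; rewrite (shannon_capacityE x) expR_ge0.
- by move=> p q a b /pt x /pt y; exact: shannon_capacity_le.
move=> p q p' q' n pq pq' E _ /andP[n0 np].
apply: (shannon_capacity_power_le (pt _ _ pq) (pt _ _ pq')) => //.
have /fraction_ge2P[_ q0 _] := pq; have /fraction_ge2P[p'0 q'0 _] := pq'.
exact: fraction_graph_power_le.
Qed.

Lemma fraction_regular_le F p q a b : fraction_regular F ->
  fraction_ge2 p q -> fraction_ge2 a b -> p%:R / q%:R <= a%:R / b%:R :> R ->
  F (fraction_graph p q) <= F (fraction_graph a b).
Proof.
move=> [_ mono _] pq ab le; apply: mono => //.
have /fraction_ge2P[_ q0 _] := pq; have /fraction_ge2P[_ b0 _] := ab.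
apply: fraction_graph_le => //; move: le.
by rewrite ler_pdivrMr ?ltr0n // mulrAC ler_pdivlMr ?ltr0n // -!natrM ler_nat.
Qed.

Lemma sup_inf_enclosure F s p' q' p q : fraction_regular F ->
  fraction_ge2 p' q' -> fraction_ge2 p q ->
  p'%:R / q'%:R < s -> s < p%:R / q%:R ->
  [/\ F (fraction_graph p' q') <= sup_below F s,
      sup_below F s <= inf_above F s &
      inf_above F s <= F (fraction_graph p q)].
Proof.
move=> reg lo hi los his.
have ub a b c d : fraction_ge2 a b -> fraction_ge2 c d ->
    a%:R / b%:R < s -> s < c%:R / d%:R ->
    F (fraction_graph a b) <= F (fraction_graph c d).
  by move=> ab cd la lc; apply: fraction_regular_le => //; apply/ltW/(lt_trans la).
split.
- apply: ub_le_sup; last by exists p', q'.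
  by exists (F (fraction_graph p q)) => _ [a [b [ab las ->]]]; exact: ub.
- apply: ge_sup; first by exists (F (fraction_graph p' q')), p', q'.
  move=> _ [a [b [ab las ->]]].
  apply: lb_le_inf; first by exists (F (fraction_graph p q)), p, q.
  by move=> _ [c [d [cd lcs ->]]]; exact: ub.
- apply: ge_inf; last by exists p, q.
  by exists (F (fraction_graph p' q')) => _ [a [b [ab las ->]]]; exact: ub.
Qed.

(** The two fractions depend on F only through the bound B on its value at an
integer above r; this is the source of uniformity over the spectrum. *)
Lemma small_oscillation r (B e : R) : 2 <= r -> irrational r -> 0 < e ->
  exists p' q' p q, [/\ fraction_ge2 p' q', fraction_ge2 p q,
    p'%:R / q'%:R < r /\ r < p%:R / q%:R &
    forall F, fraction_regular F ->
      F (fraction_graph (Num.Def.trunc r).+1 1) <= B ->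
      F (fraction_graph p q) <= F (fraction_graph p' q') + e].
Proof.
move=> r2 irr e0.
have B0 : 0 < `|B| + 1 by rewrite ltr_wpDl.
(* x <= (1 + eta) y and y <= B give x <= y + e for this choice of eta. *)
have [n n0 hn] := root_ratio_small (divr_gt0 e0 B0).
have [p [q [p' [q' [lo E [los his] nq pc]]]]] := farey_neighbours n.+1 r2 irr.
have /fraction_ge2P[p'0 q'0 ge2] := lo.
have q0 : (0 < q)%N by lia.
have hi : fraction_ge2 p q by exact: fraction_ge2_above his.
have /fraction_ge2P[_ _ pq] := hi.
exists p', q', p, q; split=> //.
  by rewrite ltr_pdivrMr ?ltr0n // ltr_pdivlMr ?ltr0n.
move=> F reg FB; have [F0 _ F3] := reg.
have c2 : fraction_ge2 (Num.Def.trunc r).+1 1.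
  apply/fraction_ge2P; split=> //; rewrite muln1 ltnW // ltnS.
  by rewrite truncn_ge_nat //; lra.
have le : F (fraction_graph p q) <= B.
  apply: le_trans FB; apply: fraction_regular_le => //.
  by rewrite divr1 ler_pdivrMr ?ltr0n // -natrM ler_nat.
have lo_le : F (fraction_graph p' q') <= F (fraction_graph p q).
  apply: fraction_regular_le => //; apply: ltW.
  by apply: (@lt_trans _ _ r); rewrite ?ltr_pdivrMr ?ltr_pdivlMr ?ltr0n.
have := hn _ _ (F0 _ _ hi) (F0 _ _ lo) (F3 _ _ _ _ n hi lo E _ _).
move=> /(_ _ _)/le_trans; apply; [by lia|by rewrite n0; lia|].
rewrite mulrDl mul1r lerD2l mulrAC ler_pdivrMr // ler_pM2l //.
by have := ler_norm B; lra.
Qed.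

End Regular.

(** * Continuity at irrational numbers *)

Section Limits.
Context {R : realType}.
Implicit Types (F : sgraph -> R) (r s x : R).

Lemma sup_below_eq_inf_above F r : 2 <= r -> irrational r ->
  fraction_regular F -> sup_below F r = inf_above F r.
Proof.
move=> r2 irr reg.
have gap e : 0 < e -> sup_below F r <= inf_above F r <= sup_below F r + e.
  move=> e0; have [p' [q' [p [q [lo hi [los his] osc]]]]] :=
    small_oscillation (F (fraction_graph (Num.Def.trunc r).+1 1)) r2 irr e0.
  have [h1 h2 h3] := sup_inf_enclosure reg lo hi los his.
  by have := osc _ reg (lexx _); rewrite h2; lra.
apply/le_anti; have /andP[-> _] := gap 1 ltr01.
by apply/ler_addgt0Pr => e /gap/andP[].
Qed.

(** For a rational x the value is read off an arbitrary representation; by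
monotonicity all representations agree. *)
Definition fraction_extension F x : R :=
  if pselect (exists pq : nat * nat,
    fraction_ge2 pq.1 pq.2 /\ pq.1%:R / pq.2%:R = x) is left h
  then F (fraction_graph (sval (cid h)).1 (sval (cid h)).2)
  else sup_below F x.

Lemma fraction_extension_fraction F p q : fraction_regular F ->
  fraction_ge2 p q ->
  fraction_extension F (p%:R / q%:R) = F (fraction_graph p q).
Proof.
move=> reg pq; rewrite /fraction_extension; case: pselect => [h|[]]; last first.
  by exists (p, q).
case: (cid h) => -[a b] /= [ab E].
by apply/le_anti/andP; split; apply: fraction_regular_le => //; rewrite E.
Qed.

Lemma fraction_extension_irrational F s : irrational s ->
  fraction_extension F s = sup_below F s.
Proof.
move=> irr; rewrite /fraction_extension; case: pselect => // h.
exfalso; apply: irr; case: h => -[a b] /= [_ E].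
by apply/rationalP; exists a%:Z, b; rewrite -pmulrn E.
Qed.

Lemma fraction_extension_between F p' q' p q x : fraction_regular F ->
  fraction_ge2 p' q' -> fraction_ge2 p q ->
  p'%:R / q'%:R < x -> x < p%:R / q%:R ->
  F (fraction_graph p' q') <= fraction_extension F x <= F (fraction_graph p q).
Proof.
move=> reg lo hi lox xhi; rewrite /fraction_extension; case: pselect => [h|_].
  case: (cid h) => -[a b] /= [ab E].
  by rewrite !fraction_regular_le ?E // ltW.
have [h1 h2 h3] := sup_inf_enclosure reg lo hi lox xhi.
by rewrite h1 (le_trans h2).
Qed.

Lemma fraction_extension_continuous F s : fraction_regular F ->
  2 <= s -> irrational s ->
  fraction_extension F x @[x --> nbhs s] --> fraction_extension F s.
Proof.
move=> reg s2 irr; apply/cvgrPdist_le => e e0.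
have [p' [q' [p [q [lo hi [los his] osc]]]]] :=
  small_oscillation (F (fraction_graph (Num.Def.trunc s).+1 1)) s2 irr e0.
have := osc _ reg (lexx _).
have /andP[s_lo s_hi] := fraction_extension_between reg lo hi los his.
have sI : s \in `](p'%:R / q'%:R), (p%:R / q%:R)[ by rewrite in_itv /= los his.
move=> gap; apply: filterS (near_in_itvoo sI) => x.
rewrite in_itv /= => /andP[lox xhi].
have /andP[x_lo x_hi] := fraction_extension_between reg lo hi lox xhi.
by rewrite ler_norml; apply/andP; split; lra.
Qed.

Lemma spectrum_uniform_limit r (e : R) : 2 <= r -> irrational r -> 0 < e ->
  exists2 d : R, 0 < d &
    forall p q, fraction_ge2 p q -> `|r - p%:R / q%:R| < d ->
    forall F, asymptotic_spectrum F ->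
      `|sup_below F r - F (fraction_graph p q)| < e.
Proof.
move=> r2 irr e0; have e20 : 0 < e / 2 by rewrite divr_gt0.
have [p' [q' [p [q [lo hi [los his] osc]]]]] :=
  small_oscillation (Num.Def.trunc r).+1%:R r2 irr e20.
exists (Num.min (r - p'%:R / q'%:R) (p%:R / q%:R - r)).
  by rewrite lt_min !subr_gt0 los his.
move=> a b ab; rewrite lt_min ltr_distlC ltr_distlC.
move=> /andP[/andP[loa _] /andP[_ ahi]] F sF.
have reg := fraction_regular_spectrum sF.
have FB : F (fraction_graph (Num.Def.trunc r).+1 1) <= (Num.Def.trunc r).+1%:R.
  have [_ _ _ FE Fle] := sF; rewrite -FE; apply: Fle.
  exists (fun u : 'I__ => u) => u v uv _; split=> //.
have gap := osc F reg FB.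
have [h1 h2 h3] := sup_inf_enclosure reg lo hi los his.
have h4 : F (fraction_graph p' q') <= F (fraction_graph a b).
  by apply: fraction_regular_le => //; apply: ltW; lra.
have h5 : F (fraction_graph a b) <= F (fraction_graph p q).
  by apply: fraction_regular_le => //; apply: ltW; lra.
by rewrite ltr_norml; apply/andP; split; lra.
Qed.

End Limits.

Theorem theorem3p14 (R : realType) (r : R) (r_ge2 : 2 <= r)
    (r_irr : irrational r) :
  (* (a) *)
  (forall F : sgraph -> R,
     [\/ asymptotic_spectrum F, F = @alphaR R | F = @shannon_capacity R] ->
     sup_below F r = inf_above F r /\
     exists Ft : R -> R,
       [/\ forall p q : nat, fraction_ge2 p q ->
             Ft (p%:R / q%:R) = F (fraction_graph p q),
           forall s : R, 2 <= s -> irrational s -> Ft s = sup_below F s &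
           forall s : R, 2 <= s -> irrational s ->
             Ft x @[x --> within `[2, +oo[ (nbhs s)] --> Ft s]) /\
  (* (b) *)
  (forall e : R, 0 < e ->
     exists2 d : R, 0 < d &
       forall p q : nat, fraction_ge2 p q -> `|r - p%:R / q%:R| < d ->
         forall F : sgraph -> R, asymptotic_spectrum F ->
           `|sup_below F r - F (fraction_graph p q)| < e) /\
  (* (c) *)
  (forall a b : nat -> nat, (forall n, fraction_ge2 (a n) (b n)) ->
     (a n)%:R / (b n)%:R @[n --> \oo] --> r ->
     spectrum_cauchy R (fun n => fraction_graph (a n) (b n))).
Proof.
have unif (e : R) : 0 < e -> exists2 d : R, 0 < d &
    forall p q : nat, fraction_ge2 p q -> `|r - p%:R / q%:R| < d ->
    forall F : sgraph -> R, asymptotic_spectrum F ->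
      `|sup_below F r - F (fraction_graph p q)| < e.
  move=> e0; exact: spectrum_uniform_limit.
split; last split=> //.
- move=> F FX.
  have reg : fraction_regular F.
    case: FX => [sF|->|->]; first exact: fraction_regular_spectrum.
      exact: fraction_regular_alpha.
    exact: fraction_regular_shannon.
  split; first exact: sup_below_eq_inf_above.
  exists (fraction_extension F); split=> [p q|s _|s s2 irr].
  + exact: fraction_extension_fraction.
  + exact: fraction_extension_irrational.
  + by apply: cvg_within_filter; exact: fraction_extension_continuous.
- move=> a b ab_ge2 ab e e0.
  have e30 : 0 < e / 3 by rewrite divr_gt0.
  have [d d0 hd] := unif _ e30.
  have /cvgrPdist_lt/(_ d d0)[N _ hN] := ab.
  exists N => m n Nm Nn; apply: (@le_lt_trans _ _ (e / 3 + e / 3)); last by lra.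
  rewrite /spectrum_dist; set S := [set _ | _].
  have [->|/set0P S0] := eqVneq S set0; first by rewrite sup0 addr_ge0 // ltW.
  apply: ge_sup S0 _ => _ [F sF ->].
  rewrite (le_trans (ler_distD (sup_below F r) _ _)) // lerD // ltW //.
    by rewrite distrC; apply: hd => //; exact: hN.
  by apply: hd => //; exact: hN.
Qed.
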